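(* Let $(\lambda,\lambda')$ be a regular pair of weights with $\lambda=(x,y)$, $\lambda'=(x',y')$. Then the composition $$M_{\lambda,\lambda'}^{\lambda\lambda'}\xrightarrow{\ \mathbf A_{\lambda,\lambda'}^{\lambda\lambda'}\ }M_{\lambda',(\lambda\lambda')^*}^{\lambda^*}\xrightarrow{\ \mathbf A_{\lambda',(\lambda\lambda')^*}^{\lambda^*}\ }M_{(\lambda\lambda')^*,\lambda}^{(\lambda')^*}\xrightarrow{\ \mathbf A_{(\lambda\lambda')^*,\lambda}^{(\lambda')^*}\ }M_{\lambda,\lambda'}^{\lambda\lambda'}$$ is $q^{-2m_{x,x'}}$ times the identity operator.
   Context: $N$ is a fixed odd positive integer, $q=e^{\pi\sqrt{-1}/N}$. $\mathcal W$ is the Hopf algebra over $\mathbb C$ generated by $X^{\pm1},Y$ with $XY=q^2YX$, $\Delta X=X\otimes X$, $\Delta Y=Y\otimes X+1\otimes Y$, $\epsilon(X)=1$, $\epsilon(Y)=0$, $S(X)=X^{-1}$, $S(Y)=-YX^{-1}$. Representations are finite dimensional complex left $\mathcal W$-modules; tensor products are formed via $\Delta$; a representation is trivial if each $W$ acts by $\epsilon(W)\,\mathrm{id}$. $e_0,\dots,e_{N-1}$ is the standard basis of $\mathbb C^N$, indices mod $N$; $Ae_k=q^{2k}e_k$, $Be_k=e_{k+1}$. For each $z\in\mathbb C^\times$ an $N$-th root $z^{1/N}$ is fixed, with $1^{1/N}=1$, $(z^{1/N})^{-1}=(z^{-1})^{1/N}=:z^{-1/N}$, $(-z)^{1/N}=-z^{1/N}$;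 $m_{z,w}\in\{0,\dots,N-1\}$ is defined by $(zw)^{1/N}=q^{2m_{z,w}}z^{1/N}w^{1/N}$. Subscripts on operators indicate the tensor factors acted on ($A_2=\mathrm{id}\otimes A$ etc.). A weight is a pair $\lambda=(x,y)\in\mathbb C^2$, non-singular if $x,y\neq0$. Product: $(x,y)(x',y')=(xx',yx'+y')$. For non-singular $\lambda=(x,y)$: $\lambda^*=(x^{-1},-yx^{-1})$ and $V_\lambda$ is $\mathbb C^N$ with $X$ acting by $x^{1/N}A$, $Y$ by $y^{1/N}B$. A pair $(\lambda,\lambda')$ of non-singular weights is regular if $X,Y$ act invertibly on $V_\lambda\otimes V_{\lambda'}$ (equivalently $\lambda\lambda'$ is also non-singular). $M^{\lambda\lambda'}_{\lambda,\lambda'}$ denotes $\mathbb C^N$ as a trivial representation. For $\mathbf a,\mathbf c\in\mathbb C$ with $\mathbf c^N-\mathbf a^N=1$ put $w(\mathbf a,\mathbf c|0)=1$, $w(\mathbf a,\mathbf c|n)=\prod_{j=1}^n(\mathbf c-\mathbf a q^{2j})^{-1}$ ($N$-periodic in $n$). For an operator $C$ with $C^N=\mathrm{id}$, $\Phi^q_{\mathbf a,\mathbf c}(C)$ acts on the $q^{2i}$-eigenspace of $C$ by $\zeta_{\mathbf a,\mathbf c}w(\mathbf a,\mathbf c|i)$, with $\zeta_{\mathbf a,\mathbf c}$ a fixed nonzero constant. For a regular pair $\lambda=(x,y),\lambda'=(x',y')$, $\mathbf F_{\lambda,\lambda'}=B_2^{-m_{x,x'}}\,\mathbf S\,\Phi^q_{\mathbf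 a,\mathbf c}(B_1A_2B_2^{-1})$, where $\mathbf S(e_i\otimes e_j)=e_i\otimes e_{i+j}$, $\mathbf a=-\frac{y^{1/N}(x')^{1/N}}{(yx'+y')^{1/N}}$, $\mathbf c=\frac{(y')^{1/N}}{(yx'+y')^{1/N}}$; it is a $\mathcal W$-isomorphism $V_\lambda\otimes V_{\lambda'}\to M^{\lambda\lambda'}_{\lambda,\lambda'}\otimes V_{\lambda\lambda'}$. For non-singular $\lambda=(x,y)$ define on $\mathbb C^N$: $C_\lambda e_i=q^{-2i\,m_{y,x^{-1}}}q^{-i(i-1)}e_{-i}$, $D_\lambda e_i=q^{-2i\,m_{y,x^{-1}}}q^{i(i-1)}e_{-i}$. For a regular pair let $I^{\lambda\lambda'}_{\lambda,\lambda'}:M^{\lambda\lambda'}_{\lambda,\lambda'}\to\mathrm{Hom}_{\mathcal W}(V_{\lambda\lambda'},V_\lambda\otimes V_{\lambda'})$ be the isomorphism $(I^{\lambda\lambda'}_{\lambda,\lambda'}f)(v)=\mathbf F^{-1}_{\lambda,\lambda'}(f\otimes v)$. Let $\mathbf A^{\mathrm{Hom}}:\mathrm{Hom}_{\mathcal W}(V_{\lambda\lambda'},V_\lambda\otimes V_{\lambda'})\to\mathrm{Hom}_{\mathcal W}(V_{\lambda^*},V_{\lambda'}\otimes V_{(\lambda\lambda')^*})$ be the isomorphism sending $f$ to the $g$ determined by $\sum_j e_j\otimes g(e_j)=(D_{\lambda^*}\otimes\mathrm{id}\otimes C_{\lambda\lambda'})\big(\sum_j f(e_j)\otimes e_j\big)$.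 Then $\mathbf A^{\lambda\lambda'}_{\lambda,\lambda'}:=(I^{\lambda^*}_{\lambda',(\lambda\lambda')^*})^{-1}\circ\mathbf A^{\mathrm{Hom}}\circ I^{\lambda\lambda'}_{\lambda,\lambda'}:M^{\lambda\lambda'}_{\lambda,\lambda'}\to M^{\lambda^*}_{\lambda',(\lambda\lambda')^*}$ (here $\lambda'(\lambda\lambda')^*=\lambda^*$, so $(\lambda',(\lambda\lambda')^* )$ is again a regular pair). *)

(* Defs.v *)
From HB Require Import structures.
From mathcomp Require Import all_boot all_order all_algebra.
From mathcomp Require Import all_classical all_reals all_analysis.
From mathcomp Require Export complex mxtens.

Set Implicit Arguments.
Unset Strict Implicit.
Unset Printing Implicit Defensive.

Import Order.TTheory GRing.Theory Num.Theory.
Local Open Scope ring_scope.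

(* Conventions: the field of complex numbers is R[i] for R : realType.        *)
(* C^N is 'cV_N with e_k = delta_mx k 0, and operators are matrices acting on *)
(* column vectors from the left; tensor products are those of mxtens          *)
(* (Kronecker products), so that C^N (x) C^N is 'cV_(N * N).                  *)

Section QuantumTorus.
Variables (R : realType) (N : nat).
Local Notation C := R[i].

Definition qroot : C := Complex (cos (pi / N%:R)) (sin (pi / N%:R)).
Local Notation q := qroot.

Definition Aop : 'M[C]_N := diag_mx (\row_k q ^+ (2 * k)).

Definition Bop : 'M[C]_N := \matrix_(i, j) (i == j.+1 %[mod N])%:R.

Definition Sop : 'M[C]_(N * N) :=
  \matrix_(k, l) (let: (i', j') := mxtens_unindex k in
                  let: (i, j) := mxtens_unindex l in
                  ((i' == i) && (j' == i + j %[mod N]))%:R).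

Definition tensv n p (v : 'cV[C]_n) (w : 'cV[C]_p) : 'cV[C]_(n * p) := v *t w.

(* The operators by which the generators X and Y of the Hopf algebra W act.   *)
Record Wmod (n : nat) := WMod { Xact : 'M[C]_n; Yact : 'M[C]_n }.

Definition is_Wmod n (V : Wmod n) : Prop :=
  Xact V \in unitmx /\ Xact V *m Yact V = q ^+ 2 *: (Yact V *m Xact V).

(* Delta X = X (x) X and Delta Y = Y (x) X + 1 (x) Y.                         *)
Definition Wtens n p (V : Wmod n) (W : Wmod p) : Wmod (n * p) :=
  WMod (Xact V *t Xact W) (Yact V *t Xact W + 1%:M *t Yact W).

Definition HomW n p (V : Wmod n) (W : Wmod p) : {vspace 'M[C]_(p, n)} :=
  (lker (linfun (mulmxr (Xact V) \- mulmx (Xact W))) :&: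
   lker (linfun (mulmxr (Yact V) \- mulmx (Yact W))))%VS.

Definition weight : Type := (C * C)%type.

Definition nonsingular (l : weight) : Prop := l.1 != 0 /\ l.2 != 0.

Definition wmul (l l' : weight) : weight := (l.1 * l'.1, l.2 * l'.1 + l'.2).

Definition wdual (l : weight) : weight := (l.1^-1, - (l.2 / l.1)).

(* The fixed choice z |-> z^{1/N} of N-th roots on the nonzero complex        *)
(* numbers; the value of rt at 0 is irrelevant.                               *)
Definition root_choice (rt : C -> C) : Prop :=
  [/\ forall z, z != 0 -> rt z ^+ N = z,
      rt 1 = 1,
      forall z, z != 0 -> rt z^-1 = (rt z)^-1
    & forall z, z != 0 -> rt (- z) = - rt z].

(* The constants zeta_{a,c} occurring in the operator functions Phi below.    *)
Definition zeta_choice (zeta : C -> C -> C) : Prop :=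
  forall a c, c ^+ N - a ^+ N = 1 -> zeta a c != 0.

Section Choices.
Variables (rt : C -> C) (zeta : C -> C -> C).

(* For nonzero z and w there is exactly one such m (q ^+ 2 is a primitive     *)
(* N-th root of unity); the default value 0 only serves z = 0 or w = 0.       *)
Definition mroot (z w : C) : nat :=
  if [pick m : 'I_N | rt (z * w) == q ^+ (2 * m) * rt z * rt w] is Some m
  then m else 0.

Definition Vrep (l : weight) : Wmod N := WMod (rt l.1 *: Aop) (rt l.2 *: Bop).

Definition regular (l l' : weight) : Prop :=
  [/\ nonsingular l, nonsingular l',
      Xact (Wtens (Vrep l) (Vrep l')) \in unitmx
    & Yact (Wtens (Vrep l) (Vrep l')) \in unitmx].

Definition wfun (a c : C) (n : nat) : C :=
  \prod_(1 <= j < n.+1) (c - a * q ^+ (2 * j))^-1.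

(* Phi a c M is the operator acting on each q^{2i}-eigenspace of M as         *)
(* prescribed. It exists and is unique as soon as M^N = id: see Phi_eigen and *)
(* Phi_uniq.                                                                  *)
Definition is_Phi n (a c : C) (M P : 'M[C]_n) : Prop :=
  forall (i : 'I_N) (v : 'cV[C]_n), M *m v = q ^+ (2 * i) *: v ->
    P *m v = (zeta a c * wfun a c i) *: v.

Definition Phi n (a c : C) (M : 'M[C]_n) : 'M[C]_n :=
  xget 0 [set P | is_Phi a c M P]%classic.

Definition Fop (l l' : weight) : 'M[C]_(N * N) :=
  let: (x, y) := l in
  let: (x', y') := l' in
  let a := - (rt y * rt x' / rt (y * x' + y')) in
  let c := rt y' / rt (y * x' + y') in
  (1%:M *t (invmx Bop ^+ mroot x x')) *m Sop *m
  Phi a c ((Bop *t 1%:M) *m (1%:M *t Aop) *m (1%:M *t invmx Bop)).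

(* Since i (i - 1) modulo 2N depends only on i modulo N, for odd N, we may    *)
(* use the representatives 0 <= i < N.                                        *)
Definition Cop (l : weight) : 'M[C]_N :=
  let m := mroot l.2 l.1^-1 in
  \matrix_(k, i) ((k + i == 0 %[mod N])%:R *
                  (q ^- (2 * i * m) * q ^- (i * i.-1))).

Definition Dop (l : weight) : 'M[C]_N :=
  let m := mroot l.2 l.1^-1 in
  \matrix_(k, i) ((k + i == 0 %[mod N])%:R *
                  (q ^- (2 * i * m) * q ^+ (i * i.-1))).

(* The matrix, with columns (I f)(e_j), of I f : v |-> F^{-1} (f (x) v).      *)
Definition Imx (l l' : weight) (f : 'cV[C]_N) : 'M[C]_(N * N, N) :=
  \matrix_(k, j) (invmx (Fop l l') *m tensv f (delta_mx j 0)) k 0.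

(* The vector (D_{l^*} (x) id (x) C_{l l'}) (sum_j f(e_j) (x) e_j) of         *)
(* C^N (x) C^N (x) C^N; the cast identifies (N * N) * N with N * (N * N).     *)
Definition Avec (l l' : weight) (f : 'M[C]_(N * N, N)) :
    'cV[C]_(N * (N * N)) :=
  (Dop (wdual l) *t (1%:M *t Cop (wmul l l'))) *m
  castmx (esym (mulnA N N N), erefl)
    (\sum_j tensv (col j f) (delta_mx j 0)).

(* The g with sum_j e_j (x) g(e_j) = Avec l l' f: see AHommxE, AHommx_uniq.   *)
Definition AHommx (l l' : weight) (f : 'M[C]_(N * N, N)) : 'M[C]_(N * N, N) :=
  \matrix_(k, j) Avec l l' f (mxtens_index (j, k)) 0.

(* V_l (x) V_l' as the target and V_nu as the source of intertwiners, where   *)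
(* nu = l l'. Keeping nu as an argument avoids a transport along the equality *)
(* l' (l l')^* = l^* of weights.                                              *)
Definition Hsp (nu l l' : weight) : {vspace 'M[C]_(N * N, N)} :=
  HomW (Vrep nu) (Wtens (Vrep l) (Vrep l')).

(* In the next two definitions vsproj only serves to view an intertwiner as   *)
(* an element of the subspace of intertwiners, on which it is the identity.   *)

(* I^{nu}_{l,l'}                                                              *)
Definition Imap (nu l l' : weight) : 'Hom('cV[C]_N, subvs_of (Hsp nu l l')) :=
  linfun (vsproj (Hsp nu l l') \o Imx l l').

Definition AHom (l l' : weight) :
    'Hom(subvs_of (Hsp (wmul l l') l l'),
         subvs_of (Hsp (wdual l) l' (wdual (wmul l l')))) :=
  linfun (vsproj (Hsp (wdual l) l' (wdual (wmul l l')))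
            \o AHommx l l' \o vsval).

(* A^{l l'}_{l,l'}; the multiplicity spaces M are all C^N.                    *)
Definition Amap (l l' : weight) : 'End('cV[C]_N) :=
  ((Imap (wdual l) l' (wdual (wmul l l')))^-1
     \o (AHom l l' \o Imap (wmul l l') l l'))%VF.

End Choices.
End QuantumTorus.

Section Facts.
Variables (R : realType) (N : nat).
Local Notation C := R[i].
Local Notation q := (qroot R N).

Lemma HomWP n p (V : Wmod R n) (W : Wmod R p) (f : 'M[C]_(p, n)) :
  reflect (f *m Xact V = Xact W *m f /\ f *m Yact V = Yact W *m f)
          (f \in HomW V W).
Proof.
apply: (iffP idP) => [|[fX fY]]; rewrite memv_cap.
  case/andP => fX fY; split; apply/eqP; rewrite -subr_eq0.
    by move: fX; rewrite memv_ker lfunE.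
  by move: fY; rewrite memv_ker lfunE.
apply/andP; split; rewrite memv_ker lfunE /= subr_eq0; exact/eqP.
Qed.

Lemma tensvE n p (v : 'cV[C]_n) (w : 'cV[C]_p) i j :
  tensv v w (mxtens_index (i, j)) 0 = v i 0 * w j 0.
Proof. by rewrite mxE mxtens_indexK; congr (v _ _ * w _ _); apply: ord1. Qed.

Lemma qroot_expE n :
  q ^+ n = Complex (cos (pi / N%:R *+ n)) (sin (pi / N%:R *+ n)).
Proof.
elim: n => [|n IH]; first by rewrite expr0 !mulr0n cos0 sin0.
rewrite exprS IH !mulrS cosD sinD; apply/eqP; rewrite eq_complex /=.
by apply/andP; split => //; rewrite addrC.
Qed.

Hypothesis N_gt0 : (0 < N)%N.

Lemma qroot_prim : N.-primitive_root (q ^+ 2).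
Proof.
have N0 : N%:R != 0 :> R by rewrite pnatr_eq0 -lt0n.
rewrite /primitive_root_of_unity N_gt0; apply/forallP => -[i ltiN] /=.
rewrite unity_rootE -exprM; case: (eqVneq i.+1 N) => [->|neqN].
  rewrite mulnC exprM qroot_expE -[_ *+ N]mulr_natr divfK // cospi sinpi.
  have -> : Complex (-1) 0 = -1 :> C by apply/eqP; rewrite eq_complex /= oppr0 !eqxx.
  by rewrite sqrrN expr1n !eqxx.
rewrite eqbF_neg; apply/negP; rewrite mulnC exprM sqrf_eq1 qroot_expE.
have : 0 < sin (pi / N%:R *+ i.+1) :> R.
  have NR : 0 < N%:R :> R by rewrite ltr0n.
  apply: sin_gt0_pi; rewrite -mulr_natr mulrAC.
  rewrite divr_gt0 ?mulr_gt0 ?pi_gt0 ?ltr0n //=.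
  rewrite ltr_pdivrMr // ltr_pM2l ?pi_gt0 // ltr_nat.
  by rewrite ltn_neqAle neqN.
rewrite lt0r => /andP [s0 _]; case/orP => /eqP; case=> _ /eqP.
  by rewrite (negbTE s0).
by rewrite oppr0 (negbTE s0).
Qed.

Lemma Aop_unit : Aop R N \in unitmx.
Proof.
rewrite unitmxE det_diag unitfE prodf_seq_neq0; apply/allP => i _ /=.
rewrite mxE exprM expf_neq0 //; apply/eqP => q0.
have := prim_expr_order qroot_prim; rewrite q0 expr0n; case: N N_gt0 => //= n _.
by move/esym/eqP; rewrite oner_eq0.
Qed.

Lemma Aop_Bop : Aop R N *m Bop R N = q ^+ 2 *: (Bop R N *m Aop R N).
Proof.
apply/matrixP => i j; rewrite mul_diag_mx !mxE.
rewrite (bigD1 j) //= big1 ?addr0 => [|k kj]; last first.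
  by rewrite !mxE (negbTE kj) mulr0n mulr0.
rewrite !mxE eqxx mulr1n.
case: eqP => [E|_]; last by rewrite mulr0n mul0r !mulr0.
rewrite !mulr1n mulr1 mul1r !exprM -exprS.
by apply/eqP; rewrite (eq_prim_root_expr qroot_prim) E.
Qed.

Lemma Vrep_is_Wmod (rt : C -> C) (l : weight R) :
  root_choice N rt -> nonsingular l -> is_Wmod N (Vrep N rt l).
Proof.
move=> [rtX _ _ _] [x0 _]; split => /=; last first.
  rewrite -!scalemxAl -!scalemxAr Aop_Bop !scalerA.
  by rewrite mulrC [rt l.1 * _]mulrC mulrA.
rewrite unitmxZ ?Aop_unit // unitfE; apply/eqP => r0.
have := rtX _ x0; rewrite r0 expr0n; case: N N_gt0 => //= n _ E.
by rewrite -E eqxx in x0.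
Qed.

Lemma Wtens_is_Wmod n p (V : Wmod R n) (W : Wmod R p) :
  (0 < n)%N -> (0 < p)%N ->
  is_Wmod N V -> is_Wmod N W -> is_Wmod N (Wtens V W).
Proof.
move=> n0 p0 [uV VV] [uW WW]; split; first by rewrite tensmx_unit -?lt0n.
rewrite /= mulmxDr mulmxDl !tensmx_mul mul1mx mulmx1 VV WW scalerDr.
by congr (_ + _); apply/matrixP => i j; rewrite !mxE; [rewrite mulrA | rewrite mulrCA].
Qed.

Section PhiFacts.
Variables (zeta : C -> C -> C) (n : nat) (a c : C) (M : 'M[C]_n).
Hypothesis MN : M ^+ N = 1.

Let w := q ^+ 2.

Let proj (i : nat) : 'M[C]_n :=
  N%:R^-1 *: \sum_(k < N) (w ^- i) ^+ k *: M ^+ k.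

Let w0 : w != 0.
Proof.
apply/eqP => w0; have := prim_expr_order qroot_prim.
rewrite -/w w0 expr0n; case: N N_gt0 => //= k _.
by move/esym/eqP; rewrite oner_eq0.
Qed.

Let NC0 : N%:R != 0 :> C. Proof. by rewrite pnatr_eq0 -lt0n. Qed.

Let geom (x : C) : x ^+ N = 1 -> \sum_(k < N) x ^+ k = (x == 1)%:R * N%:R.
Proof.
move=> xN; case: eqP => [->|/eqP x1]; last first.
  apply: (@mulfI _ (x - 1)); first by rewrite subr_eq0.
  by rewrite -subrX1 xN subrr mul0r mulr0.
by rewrite (eq_bigr (fun=> 1)) ?sumr_const ?card_ord ?mul1r // => k _; rewrite expr1n.
Qed.

Let wN : w ^+ N = 1. Proof. exact: (prim_expr_order qroot_prim). Qed.

Let eigX (i : nat) (v : 'cV[C]_n) k :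
  M *m v = w ^+ i *: v -> M ^+ k *m v = (w ^+ i) ^+ k *: v.
Proof.
move=> Mv; elim: k => [|k IH]; first by rewrite !expr0 scale1r mul1mx.
rewrite exprS -[(M * _)%R]/(M *m _) -mulmxA IH -scalemxAr Mv scalerA.
by rewrite -exprSr.
Qed.

Let proj_eig (i j : 'I_N) (v : 'cV[C]_n) :
  M *m v = w ^+ j *: v -> proj i *m v = (i == j)%:R *: v.
Proof.
move=> Mv; rewrite /proj -scalemxAl mulmx_suml.
under eq_bigr => k _ do rewrite -scalemxAl (eigX _ Mv) scalerA -exprMn.
rewrite -scaler_suml geom; last first.
  by rewrite exprMn exprVn -!exprM ![(_ * N)%N]mulnC !exprM wN !expr1n invr1 mulr1.
have wi : w ^+ i != 0 by rewrite expf_neq0.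
have -> : (w ^- i * w ^+ j == 1) = (i == j).
  rewrite -(inj_eq (mulfI wi)) mulrA divff // mul1r mulr1.
  rewrite (eq_prim_root_expr qroot_prim) !modn_small // -val_eqE /=.
  by rewrite eq_sym.
by rewrite scalerA mulrCA mulVf // mulr1.
Qed.

Let proj_im (i : 'I_N) : M *m proj i = w ^+ i *: proj i.
Proof.
have wi : w ^+ i != 0 by rewrite expf_neq0.
rewrite /proj -scalemxAr scalerA mulrC -scalerA; congr (_ *: _).
rewrite mulmx_sumr scaler_sumr.
have F k : M *m ((w ^- i) ^+ k *: M ^+ k)
   = w ^+ i *: ((w ^- i) ^+ k.+1 *: M ^+ k.+1).
  rewrite -scalemxAr scalerA [(w ^- i) ^+ k.+1]exprS mulrA divff // mul1r.
  by rewrite [M ^+ k.+1]exprS.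
under eq_bigr => k _ do rewrite F.
rewrite -!scaler_sumr; congr (_ *: _).
rewrite -(big_mkord xpredT (fun k => (w ^- i) ^+ k.+1 *: M ^+ k.+1)).
rewrite -(big_mkord xpredT (fun k => (w ^- i) ^+ k *: M ^+ k)).
rewrite -(big_add1 _ _ 0 N.+1 xpredT (fun k => (w ^- i) ^+ k *: M ^+ k)).
rewrite [RHS]big_ltn // big_nat_recr //= addrC; congr (_ + _).
by rewrite MN !expr0 exprVn -exprM mulnC exprM wN expr1n invr1.
Qed.

Let proj_sum : \sum_(i < N) proj i = 1%:M.
Proof.
rewrite /proj -scaler_sumr exchange_big /=.
have F (k : 'I_N) : \sum_(i < N) (w ^- i) ^+ k *: M ^+ k
   = ((val k == 0%N)%:R * N%:R) *: M ^+ k.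
  rewrite -scaler_suml; congr (_ *: _).
  transitivity (\sum_(i < N) (w ^- k) ^+ i).
    by apply: eq_bigr => i _; rewrite !exprVn [w ^+ i ^+ k]exprAC.
  rewrite geom; last by rewrite exprVn -exprM mulnC exprM wN expr1n invr1.
  rewrite invr_eq1 -(expr0 w) (eq_prim_root_expr qroot_prim).
  by rewrite mod0n modn_small.
under eq_bigr => k _ do rewrite F.
rewrite (bigD1 (Ordinal N_gt0)) //= big1 ?addr0 => [|k k0].
  by rewrite mul1r scalerA mulVf // scale1r expr0.
by rewrite -val_eqE /= in k0; rewrite (negbTE k0) mul0r scale0r.
Qed.

Lemma Phi_uniq P Q : is_Phi N zeta a c M P -> is_Phi N zeta a c M Q -> P = Q.
Proof.
move=> hP hQ; rewrite -[P]mulmx1 -[Q]mulmx1 -proj_sum !mulmx_sumr.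
apply: eq_bigr => i _; apply/matrixP => k j.
have E T : (T *m proj i) k j = (T *m col j (proj i)) k 0.
  by rewrite colE mulmxA -colE [RHS]mxE.
have Mc : M *m col j (proj i) = q ^+ (2 * i) *: col j (proj i).
  by rewrite colE mulmxA proj_im exprM scalemxAl.
by rewrite !E (hP _ _ Mc) (hQ _ _ Mc).
Qed.

Lemma Phi_eigen : is_Phi N zeta a c M (Phi N zeta a c M).
Proof.
suff [P hP] : exists P, is_Phi N zeta a c M P by apply: (xgetPex 0); exists P.
exists (\sum_(i < N) (zeta a c * wfun N a c i) *: proj i) => j v Mv.
have Mv' : M *m v = w ^+ j *: v by rewrite Mv exprM.
rewrite mulmx_suml (bigD1 j) //= big1 ?addr0 => [|i ij].
  by rewrite -scalemxAl (proj_eig _ Mv') eqxx scale1r.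
by rewrite -scalemxAl (proj_eig _ Mv') (negbTE ij) scale0r scaler0.
Qed.

End PhiFacts.

Section AHomFacts.
Variables (rt : C -> C) (l l' : weight R) (f : 'M[C]_(N * N, N)).

Let sum_tensE (g : 'M[C]_(N * N, N)) i k :
  (\sum_j tensv (delta_mx j 0) (col j g)) (mxtens_index (i, k)) 0 = g k i.
Proof.
rewrite summxE (bigD1 i) //= big1 ?addr0 => [|j ji].
  by rewrite tensvE !mxE !eqxx mul1r.
by rewrite tensvE !mxE eq_sym (negbTE ji) mul0r.
Qed.

Lemma AHommxE :
  \sum_j tensv (delta_mx j 0) (col j (AHommx rt l l' f)) = Avec rt l l' f.
Proof.
apply/colP => k; case: (mxtens_indexP k) => i {}k.
by rewrite sum_tensE mxE.
Qed.

Lemma AHommx_uniq g :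
  \sum_j tensv (delta_mx j 0) (col j g) = Avec rt l l' f ->
  g = AHommx rt l l' f.
Proof. by move=> E; apply/matrixP => k j; rewrite mxE -E sum_tensE. Qed.

End AHomFacts.
End Facts.

(* Main.v *)
Require Import Defs.
From HB Require Import structures.
From mathcomp Require Import all_boot all_order all_algebra.
From mathcomp Require Import all_classical all_reals all_analysis.
From mathcomp Require Import ring zify.

Set Implicit Arguments.
Unset Strict Implicit.
Unset Printing Implicit Defensive.

Import GRing.Theory Num.Theory.
Local Open Scope ring_scope.

(* View an intertwiner f : V_{ll'} -> V_l (x) V_l' as a tensor in C^N (x) C^N
   (x) C^N. Then A^Hom is the cyclic rotation of the three factors composed with
   D_{l^*} on the first and C_{ll'} on the third one. Applied three times, the
   rotations cancel and each factor meets one C and one D with the same weight;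
   as C D = A^{-1} and D C = A, the result is f |-> (A^{-1} (x) A^{-1}) f A,
   which is q^{-2m_{x,x'}} f because f intertwines the actions of X.
   It remains to see that the maps I are bijective: F conjugates V_l (x) V_l'
   into 1 (x) V_{ll'}, and A, B have only scalars as common commutant. *)

(** [Imap] and [AHom] apply [linfun] to bare functions, so the structure that [lfunE] expects is
    packed here from a proof of linearity. *)
Lemma linfunE_of_linear (K : fieldType) (aT rT : vectType K) (f : aT -> rT) :
  linear f -> linfun f =1 f.
Proof.
move=> lin_f; pose F : {linear aT -> rT} := HB.pack f (GRing.isLinear.Build _ _ _ _ f lin_f).
exact: (lfunE F).
Qed.

(** * Cyclic rotation of three tensor factors *)

Section TensorRotation.
Variables (C : comPzRingType) (N : nat).
Implicit Types (P Q S : 'M[C]_N) (f : 'M[C]_(N * N, N)).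

Lemma big_mxtens_index m n (F : 'I_(m * n) -> C) :
  \sum_k F k = \sum_i \sum_j F (mxtens_index (i, j)).
Proof.
rewrite pair_big /= (reindex (@mxtens_index m n)) /=.
  by apply: eq_bigr => -[i j].
by exists (@mxtens_unindex m n) => k _; rewrite ?mxtens_indexK ?mxtens_unindexK.
Qed.

(** The entries of [f] form a tensor with target indices a, b and source index c; the same tensor is
    re-read as a map from its first factor to the other two. *)
Definition mxrot f : 'M[C]_(N * N, N) :=
  \matrix_(k, a) f (mxtens_index (a, (mxtens_unindex k).1)) (mxtens_unindex k).2.

Lemma mxrotE f a b c : mxrot f (mxtens_index (b, c)) a = f (mxtens_index (a, b)) c.
Proof. by rewrite mxE mxtens_indexK. Qed.

Lemma mxrot_cube f : mxrot (mxrot (mxrot f)) = f.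
Proof.
apply/matrixP => k c; case: (mxtens_indexP k) => a b.
by rewrite !mxrotE.
Qed.

Lemma tens_mul_trE P Q S f a b c :
  ((P *t Q) *m f *m S^T) (mxtens_index (a, b)) c =
  \sum_a' \sum_b' \sum_c' P a a' * Q b b' * S c c' * f (mxtens_index (a', b')) c'.
Proof.
rewrite -mulmxA mxE big_mxtens_index; apply: eq_bigr => a' _.
apply: eq_bigr => b' _; rewrite tensmxE mxE mulr_sumr; apply: eq_bigr => c' _.
by rewrite mxE; ring.
Qed.

(** The operators travel with their factors; the one on the factor that serves as source stands
    transposed on the right. *)
Lemma mxrot_tens_mul P Q S f :
  mxrot ((P *t Q) *m f *m S^T) = (Q *t S) *m mxrot f *m P^T.
Proof.
apply/matrixP => k a; case: (mxtens_indexP k) => b c.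
rewrite mxrotE !tens_mul_trE exchange_big; apply: eq_bigr => b' _ /=.
rewrite exchange_big; apply: eq_bigr => c' _; apply: eq_bigr => a' _ /=.
by rewrite mxrotE; congr (_ * _); ring.
Qed.

Lemma tensmxNl m n p r (P : 'M[C]_(m, n)) (S : 'M[C]_(p, r)) : (- P) *t S = - (P *t S).
Proof. by apply/matrixP => i j; rewrite !mxE mulNr. Qed.

Lemma tensmxZl m n p r a (P : 'M[C]_(m, n)) (S : 'M[C]_(p, r)) : (a *: P) *t S = a *: (P *t S).
Proof. by apply/matrixP => i j; rewrite !mxE mulrA. Qed.

Lemma tensmxZr m n p r a (P : 'M[C]_(m, n)) (S : 'M[C]_(p, r)) : P *t (a *: S) = a *: (P *t S).
Proof. by apply/matrixP => i j; rewrite !mxE mulrCA. Qed.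

Lemma tensmx1 : (1%:M : 'M[C]_N) *t (1%:M : 'M[C]_N) = 1%:M.
Proof.
apply/matrixP => i j; case: (mxtens_indexP i) => a b; case: (mxtens_indexP j) => a' b'.
by rewrite tensmxE !mxE -natrM mulnb (inj_eq (can_inj (@mxtens_indexK N N))) xpair_eqE.
Qed.

Section Intertwiners.
Variables (X Y X' Y' Xn Yn Xs Ys Xns Yns D E : 'M[C]_N) (f : 'M[C]_(N * N, N)).
(** [DX] and [DY] say that u^T D v is an invariant pairing of ([Xs], [Ys]) with ([X], [Y]), and [EX]
    and [EY] that sum_ij E_ij e_j (x) e_i is an invariant vector of ([Xn], [Yn]) (x) ([Xns], [Yns]).
    The rotation of [h] creates this vector to the right of its argument, applies [f] to the first
    half and pairs the argument with the first factor obtained: a composite of intertwiners. *)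
Hypotheses (DX : Xs^T *m D *m X = D) (DY : D *m Y = - (Ys^T *m D *m X)).
Hypotheses (EX : Xns *m E *m Xn^T = E) (EY : Yns *m E = - (Xns *m E *m Yn^T)).
Hypotheses (fX : f *m Xn = (X *t X') *m f).
Hypotheses (fY : f *m Yn = (Y *t X' + 1%:M *t Y') *m f).
Let h := (D *t 1%:M) *m f *m E^T.

Lemma mxrotD (g k : 'M[C]_(N * N, N)) : mxrot (g + k) = mxrot g + mxrot k.
Proof. by apply/matrixP => i j; rewrite !mxE. Qed.

Let trEX : E^T = Xn *m E^T *m Xns^T.
Proof. by rewrite -[in LHS]EX !trmx_mul trmxK mulmxA. Qed.

Let trEY : E^T *m Yns^T = - (Yn *m E^T *m Xns^T).
Proof. by rewrite -trmx_mul EY linearN /= !trmx_mul trmxK mulmxA. Qed.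

Let rotl P : mxrot h *m P = mxrot ((P^T *t 1%:M) *m h).
Proof.
by have := mxrot_tens_mul P^T 1%:M 1%:M h; rewrite trmx1 mulmx1 tensmx1 mul1mx trmxK => ->.
Qed.

Let rotr Q S : (Q *t S) *m mxrot h = mxrot ((1%:M *t Q) *m h *m S^T).
Proof. by have := mxrot_tens_mul 1%:M Q S h; rewrite trmx1 mulmx1 => ->. Qed.

Let push (P Q S T Z : 'M[C]_N) :
  (P *t Q) *m ((S *t T) *m f *m Z) = ((P *m S) *t (Q *m T)) *m f *m Z.
Proof. by rewrite !mulmxA tensmx_mul. Qed.

Lemma mxrot_intertwineX : mxrot h *m Xs = (X' *t Xns) *m mxrot h.
Proof.
rewrite rotl rotr /h !push mul1mx mulmx1 mul1mx; congr (mxrot _).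
rewrite trEX !mulmxA -(mulmxA _ f) fX mulmxA tensmx_mul mul1mx DX.
by rewrite -!mulmxA; congr (_ *m (_ *m _)); rewrite !mulmxA -trEX.
Qed.

Lemma mxrot_intertwineY : mxrot h *m Ys = (Y' *t Xns + 1%:M *t Yns) *m mxrot h.
Proof.
rewrite rotl mulmxDl !rotr /h !push -mxrotD !mul1mx !mulmx1; congr (mxrot _).
rewrite -!(mulmxA _ E^T) trEY -(mulmxA Yn); move: trEX; rewrite -mulmxA.
(* Here E^T = [Xn] [Z]. The terms D (x) Y' cancel, [DY] turns D Y (x) X' into -(Ys^T D (x) 1)(X (x)
   X'), and [fX] yields the matching X (x) X' from [f] [Xn]. *)
set Z := E^T *m _ => ->; rewrite -!(mulmxA _ f) !(mulmxA f) fX mulmxN (mulmxA f) fY.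
rewrite mulmxN !mulmxDl mulmxDr opprD -!(mulmxA _ f) !(mulmxA (_ *t _)) !tensmx_mul.
by rewrite !mul1mx !mulmx1 DY tensmxNl mulNmx opprK addrCA -(mulmxA _ _ Xns^T) -/Z
  -!mulmxA subrr addr0.
Qed.

End Intertwiners.

(** Each rotation moves the first factor to the last place: the factor hit by [D1] next meets [E2],
    that of [D2] meets [E3], and that of [E1] comes first in the third step and meets [D3]. *)
Lemma mxrot3 (D1 D2 D3 E1 E2 E3 : 'M[C]_N) (f : 'M[C]_(N * N, N)) :
  mxrot ((D3 *t 1%:M) *m
    mxrot ((D2 *t 1%:M) *m mxrot ((D1 *t 1%:M) *m f *m E1^T) *m E2^T) *m E3^T) =
  ((E2 *m D1) *t (E3 *m D2)) *m f *m (D3 *m E1)^T.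
Proof.
rewrite (mxrot_tens_mul D1) !mulmxA tensmx_mul mul1mx mulmx1 -(mulmxA _ _ E2^T) -trmx_mul.
rewrite (mxrot_tens_mul D2) !mulmxA tensmx_mul mul1mx -(mulmxA _ _ E3^T) -trmx_mul.
by rewrite mxrot_tens_mul mxrot_cube.
Qed.

End TensorRotation.

(** * The matrices A and B on the standard basis *)

Section QuantumTorusModules.
Variables (R : realType) (N : nat).
Hypothesis oddN : odd N.
Local Notation C := R[i].
Local Notation q := (qroot R N).
Local Notation w := (q ^+ 2).
Local Notation A := (Aop R N).
Local Notation B := (Bop R N).

Let N_pos : (0 < N)%N. Proof. exact: odd_gt0. Qed.

Lemma w_prim : N.-primitive_root w. Proof. exact: qroot_prim N_pos. Qed.

Lemma wN : w ^+ N = 1. Proof. exact: prim_expr_order w_prim. Qed.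

Lemma w_neq0 : w != 0.
Proof.
by rewrite -unitfE; apply/unitrPr; exists (w ^+ N.-1); rewrite -exprS prednK ?wN.
Qed.

Lemma expw_mod k : w ^+ (k %% N) = w ^+ k.
Proof. exact: prim_expr_mod w_prim k. Qed.

Lemma expw_eq j k : j = k %[mod N] -> w ^+ j = w ^+ k.
Proof. by move=> jk; rewrite -expw_mod jk expw_mod. Qed.

Lemma sum_expw (k : nat) :
  \sum_(i < N) (w ^+ i) ^+ k = if (N %| k)%N then N%:R else 0.
Proof.
transitivity (\sum_(i < N) (w ^+ k) ^+ i).
  by apply: eq_bigr => i _; rewrite exprAC.
rewrite (prim_order_dvd w_prim); case: eqP => [->|/eqP wk].
  by under eq_bigr do rewrite expr1n; rewrite sumr_const card_ord.
apply: (@mulfI _ (w ^+ k - 1)); first by rewrite subr_eq0.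
by rewrite -subrX1 [X in X - 1]exprAC wN expr1n subrr mulr0.
Qed.

(** Indices are arbitrary natural numbers read modulo N, so that shifts involve no wraparound. *)
Definition ebasis (k : nat) : 'cV[C]_N := \col_i (i == k %[mod N])%:R.

Lemma ebasis_ord (i : 'I_N) : ebasis i = delta_mx i 0.
Proof. by apply/colP => j; rewrite !mxE eqxx andbT !modn_small. Qed.

Lemma ebasis_mod j k : j = k %[mod N] -> ebasis j = ebasis k.
Proof. by move=> jk; apply/colP => i; rewrite !mxE jk. Qed.

Lemma eq_on_ebasis m (P Q : 'M[C]_(m, N)) :
  (forall k, P *m ebasis k = Q *m ebasis k) -> P = Q.
Proof.
by move=> E; apply/matrixP => i j; have /colP/(_ i) := E j; rewrite ebasis_ord -!colE !mxE.
Qed.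

(** Every residue is a successor, and on e_{k+1} the inverse of B acts without subtraction in
    [nat]. *)
Lemma eq_on_ebasisS m (P Q : 'M[C]_(m, N)) :
  (forall k, P *m ebasis k.+1 = Q *m ebasis k.+1) -> P = Q.
Proof.
move=> E; apply: eq_on_ebasis => k; rewrite (@ebasis_mod k (k + N.-1).+1) //.
by rewrite -addnS prednK ?N_pos // modnDr.
Qed.

Lemma tensv_delta (i j : 'I_N) :
  tensv (delta_mx i 0 : 'cV[C]_N) (delta_mx j 0) = delta_mx (mxtens_index (i, j)) 0.
Proof.
apply/colP => k; case: (mxtens_indexP k) => a b; rewrite tensvE !mxE !eqxx !andbT.
by rewrite (inj_eq (can_inj (@mxtens_indexK N N))) xpair_eqE -natrM mulnb.
Qed.

Lemma eq_on_tens m (P Q : 'M[C]_(m, N * N)) :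
  (forall j k, P *m tensv (ebasis j) (ebasis k) = Q *m tensv (ebasis j) (ebasis k)) ->
  P = Q.
Proof.
move=> E; apply/matrixP => i j; case: (mxtens_indexP j) => a b.
by have /colP/(_ i) := E a b; rewrite !ebasis_ord tensv_delta -!colE !mxE.
Qed.

Lemma tensv_mul n p n' p' (P : 'M[C]_(n', n)) (Q : 'M[C]_(p', p)) u v :
  (P *t Q) *m tensv u v = tensv (P *m u) (Q *m v).
Proof. exact: (tensmx_mul P Q u v). Qed.

Lemma tensvZl n p a (u : 'cV[C]_n) (v : 'cV[C]_p) : tensv (a *: u) v = a *: tensv u v.
Proof. by apply/matrixP => i j; rewrite !mxE mulrA. Qed.

Lemma tensvZr n p a (u : 'cV[C]_n) (v : 'cV[C]_p) : tensv u (a *: v) = a *: tensv u v.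
Proof. by apply/matrixP => i j; rewrite !mxE mulrCA. Qed.

Lemma Aop_ebasis k : A *m ebasis k = w ^+ k *: ebasis k.
Proof.
apply/colP => i; rewrite mul_diag_mx !mxE exprM.
by case: eqP => [/expw_eq->|_]; rewrite ?mulr0.
Qed.

Lemma Bop_ebasis k : B *m ebasis k = ebasis k.+1.
Proof.
rewrite (@ebasis_mod k (k %% N)) ?modn_mod // (@ebasis_mod k.+1 (k %% N).+1); last first.
  by rewrite -addn1 -modnDml addn1.
rewrite -[(k %% N)%N]/(nat_of_ord (Ordinal (ltn_pmod k N_pos))) ebasis_ord -colE.
by apply/colP => i; rewrite !mxE.
Qed.

Lemma BopX_ebasis j k : (B ^+ j) *m ebasis k = ebasis (j + k).
Proof.
elim: j => [|j IH]; first by rewrite expr0 mul1mx.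
by rewrite exprS -[(_ * _)%R]/(_ *m _) -mulmxA IH Bop_ebasis.
Qed.

Lemma Bop_unit : B \in unitmx.
Proof.
have : B *m B ^+ N.-1 = 1%:M.
  apply: eq_on_ebasis => k; rewrite -mulmxA BopX_ebasis Bop_ebasis mul1mx.
  by apply: ebasis_mod; rewrite -addSn prednK ?N_pos ?modnDl.
by case/mulmx1_unit.
Qed.

Lemma invBop_ebasis k : invmx B *m ebasis k.+1 = ebasis k.
Proof. by rewrite -Bop_ebasis mulKmx ?Bop_unit. Qed.

Lemma Bop_tr : B^T = invmx B.
Proof.
apply: eq_on_ebasisS => k; rewrite invBop_ebasis; apply/colP => i.
rewrite (@ebasis_mod k.+1 (k.+1 %% N)) ?modn_mod //.
rewrite -[(k.+1 %% N)%N]/(nat_of_ord (Ordinal (ltn_pmod k.+1 N_pos))) ebasis_ord -colE !mxE /=.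
by rewrite modn_mod -[k.+1]addn1 -[i.+1]addn1 eqn_modDr eq_sym.
Qed.

Lemma Sop_ebasis j k :
  Sop R N *m tensv (ebasis j) (ebasis k) = tensv (ebasis j) (ebasis (j + k)).
Proof.
rewrite (@ebasis_mod j (j %% N)) ?modn_mod // (@ebasis_mod k (k %% N)) ?modn_mod //.
rewrite (@ebasis_mod (j + k) (j %% N + k %% N)) ?modnDm //.
rewrite -[(k %% N)%N]/(nat_of_ord (Ordinal (ltn_pmod k N_pos))).
rewrite -[(j %% N)%N]/(nat_of_ord (Ordinal (ltn_pmod j N_pos))).
rewrite !ebasis_ord tensv_delta -colE; apply/colP => i; case: (mxtens_indexP i) => a b.
by rewrite tensvE !mxE !mxtens_indexK eqxx andbT -natrM mulnb.
Qed.

(** * Spectral calculus of an operator with U^N = 1, and the function Phi *)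

Section Eigenspaces.
Variables (n : nat) (U : 'M[C]_n).
Hypothesis UN : U ^+ N = 1.

(** The cofactor of U - w^i in U^N - w^(iN) = 0. It is N w^(-i) on the w^i-eigenspace and 0 on the
    others: a spectral projector up to a scalar. *)
Definition eigproj (i : nat) : 'M[C]_n :=
  \sum_(k < N) (w ^+ i) ^+ k *: U ^+ (N.-1 - k).

Lemma eigprojP i : U *m eigproj i = w ^+ i *: eigproj i.
Proof.
have cUw : GRing.comm U (w ^+ i)%:M by exact: comm_mx_scalar.
have wX k : (w ^+ i)%:M ^+ k = ((w ^+ i) ^+ k)%:M :> 'M[C]_n.
  by elim: k => [|k IH]; rewrite ?expr0 // exprS IH [in RHS]exprS -[LHS]scalar_mxM.
have E : eigproj i = \sum_(k < N) U ^+ (N.-1 - k) * (w ^+ i)%:M ^+ k.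
  by apply: eq_bigr => k _; rewrite wX -[LHS]mul_mx_scalar.
apply/eqP; rewrite -subr_eq0 -mul_scalar_mx -mulmxBl; apply/eqP.
rewrite -[_ *m _]/((U - (w ^+ i)%:M) * eigproj i) E.
by rewrite -subrXX_comm // UN wX exprAC wN expr1n subrr.
Qed.

(** Summing over i kills every power of U except U^(N-1), the inverse of U. *)
Lemma sum_eigproj : (\sum_(i < N) eigproj i) *m U = N%:R%:M.
Proof.
rewrite exchange_big /= (bigD1 (Ordinal N_pos)) //= [X in _ + X]big1 => [|k k0].
  rewrite addr0 -scaler_suml sum_expw // dvdn0 -scalemxAl subn0.
  by rewrite -[_ *m U]/(_ * U) -exprSr prednK // UN scalemx1.
rewrite -scaler_suml sum_expw // gtnNdvd ?scale0r //.
by rewrite lt0n -val_eqE in k0 *.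
Qed.

(** The columns of the [eigproj i] are eigenvectors by [eigprojP] and span by [sum_eigproj]. *)
Lemma eq_on_eigenvectors (P Q : 'M[C]_n) :
  (forall i (v : 'cV[C]_n), U *m v = w ^+ i *: v -> P *m v = Q *m v) -> P = Q.
Proof.
move=> E.
have NC : N%:R != 0 :> C by rewrite pnatr_eq0 -lt0n.
have EP i : P *m eigproj i = Q *m eigproj i.
  apply/matrixP => a b.
  have /E/colP/(_ a) : U *m col b (eigproj i) = w ^+ i *: col b (eigproj i).
    by rewrite colE mulmxA eigprojP scalemxAl.
  by rewrite !colE !mulmxA -!colE !mxE.
suff : N%:R *: P = N%:R *: Q by apply: scalerI.
rewrite -!mul_mx_scalar -sum_eigproj !mulmxA !mulmx_sumr.
by congr (_ *m _); apply: eq_bigr => i _.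
Qed.

Variables (zeta : C -> C -> C) (a c : C).
Hypotheses (zeta_neq0 : zeta a c != 0) (ac1 : c ^+ N - a ^+ N = 1).
Local Notation Phi := (Phi N zeta a c U).

(* [\prod_j (c - a w ^ j) = c ^ N - a ^ N] *)
Lemma prod_csubaw : \prod_(1 <= j < N.+1) (c - a * q ^+ (2 * j)) = 1.
Proof.
have -> : \prod_(1 <= j < N.+1) (c - a * q ^+ (2 * j)) = \prod_(0 <= j < N) (c - a * w ^+ j).
  rewrite big_nat_recr //= [RHS]big_ltn // mulrC; congr (_ * _).
    by rewrite exprM wN expr0.
  by apply: eq_bigr => j _; rewrite exprM.
(* For a = 0 both sides are c^N; otherwise the factorization of X^N - 1 is evaluated at c / a and
   multiplied by a^N. *)
rewrite -[RHS]ac1; have [->|a0] := eqVneq a 0.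
  under eq_bigr do rewrite mul0r subr0.
  by rewrite expr0n gtn_eqF // subr0 prodr_const_nat subn0.
have := congr1 (horner^~ (c / a)) (factor_Xn_sub_1 w_prim).
rewrite !hornerE horner_prod => /(congr1 ( *%R (a ^+ N))).
rewrite mulrBr mulr1 -exprMn mulrCA divff // mulr1 => <-.
rewrite -[X in a ^+ X]subn0 -prodr_const_nat -big_split /=.
by apply: eq_bigr => j _; rewrite !hornerE mulrBr mulrCA divff ?mulr1.
Qed.

Lemma csubaw_neq0 i : c - a * w ^+ i != 0.
Proof.
have /negP nz : ~~ (\prod_(1 <= j < N.+1) (c - a * q ^+ (2 * j)) == 0).
  by rewrite prod_csubaw oner_eq0.
apply/negP => E; apply: nz; rewrite prodf_seq_eq0; apply/hasP.
(* The representative of i modulo N in the range 1, ..., N of the product: residue 0 becomes N. *)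
exists (i %% N + (i %% N == 0) * N)%N; last first.
  by rewrite /= exprM (@expw_eq _ i) // addnC modnMDl modn_mod.
rewrite mem_index_iota; have := ltn_pmod i N_pos.
by case: (i %% N)%N => [|k] kN; rewrite ?mul1n ?mul0n ?addn0 ?add0n ?N_pos ?leqnn //= ltnS ltnW.
Qed.

Lemma wfun_neq0 i : wfun N a c i != 0.
Proof.
rewrite prodf_seq_neq0; apply/allP => j _ /=.
by rewrite invr_eq0 exprM csubaw_neq0.
Qed.

Lemma wfunS i : (c - a * w ^+ i.+1) * wfun N a c i.+1 = wfun N a c i.
Proof.
by rewrite /wfun big_nat_recr //= exprM mulrCA mulfV ?mulr1 ?csubaw_neq0.
Qed.

(** The product over a full period is 1, which gives index N; the recursion [wfunS] propagates the
    period to all indices. *)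
Lemma wfun_mod i : wfun N a c (i %% N) = wfun N a c i.
Proof.
have per j : wfun N a c (j + N) = wfun N a c j.
  elim: j => [|j IH].
    by rewrite add0n /wfun [RHS]big_geq // prodfV prod_csubaw invr1.
  apply: (mulfI (csubaw_neq0 j.+1)); rewrite wfunS -IH -(wfunS (j + N)) addSn.
  by rewrite (@expw_eq (j + N).+1 j.+1) // -addSn modnDr.
rewrite [in RHS](divn_eq i N) addnC.
by elim: (i %/ N)%N => [|k IH]; rewrite ?addn0 // mulSn [(N + _)%N]addnC addnA per.
Qed.

Lemma Phi_eigenvector i (v : 'cV[C]_n) :
  U *m v = w ^+ i *: v -> Phi *m v = (zeta a c * wfun N a c i) *: v.
Proof.
move=> Uv; have := @Phi_eigen _ _ N_pos zeta n a c U (Ordinal (ltn_pmod i N_pos)) v.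
rewrite exprM /= expw_mod // wfun_mod; exact.
Qed.

Lemma Phi_unit : Phi \in unitmx.
Proof.
(* [P] divides by the eigenvalues of Phi; the later factor U / N undoes the normalization of
   [eigproj]. *)
pose P := \sum_(i < N) (zeta a c * wfun N a c i)^-1 *: eigproj i.
have NC : N%:R != 0 :> C by rewrite pnatr_eq0 -lt0n.
have : Phi *m (P *m (N%:R^-1 *: U)) = 1%:M.
  rewrite -!scalemxAr mulmxA mulmx_sumr.
  suff -> : \sum_(i < N) Phi *m ((zeta a c * wfun N a c i)^-1 *: eigproj i)
     = \sum_(i < N) eigproj i.
    by rewrite sum_eigproj scale_scalar_mx mulVf.
  apply: eq_bigr => i _; rewrite -scalemxAr; apply/matrixP => k l.
  have /Phi_eigenvector/colP/(_ k) : U *m col l (eigproj i) = w ^+ i *: col l (eigproj i).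
    by rewrite colE mulmxA eigprojP scalemxAl.
  rewrite colE mulmxA -!colE !mxE => ->.
  by rewrite mulrA mulVf ?mul1r // mulf_neq0 // wfun_neq0.
by case/mulmx1_unit.
Qed.

Lemma Phi_comm (T : 'M[C]_n) : U *m T = T *m U -> Phi *m T = T *m Phi.
Proof.
move=> UT; apply: eq_on_eigenvectors => i v Uv.
have UTv : U *m (T *m v) = w ^+ i *: (T *m v) by rewrite mulmxA UT -mulmxA Uv scalemxAr.
by rewrite -!mulmxA (Phi_eigenvector UTv) (Phi_eigenvector Uv) scalemxAr.
Qed.

(* [T] shifts the eigenspaces of [U] by one, so that [wfunS] applies. *)
Lemma Phi_shift (T : 'M[C]_n) : U *m T = w *: (T *m U) ->
  (c%:M - a *: U) *m Phi *m T = T *m Phi.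
Proof.
move=> UT; apply: eq_on_eigenvectors => i v Uv.
have UTv : U *m (T *m v) = w ^+ i.+1 *: (T *m v).
  by rewrite mulmxA UT -scalemxAl -mulmxA Uv -scalemxAr scalerA -exprS.
rewrite -!mulmxA (Phi_eigenvector UTv) (Phi_eigenvector Uv) -!scalemxAr.
rewrite mulmxBl mul_scalar_mx -scalemxAl UTv scalerA -scalerBl scalerA.
by rewrite -mulrA [_ * (c - _)]mulrC wfunS.
Qed.

End Eigenspaces.

(** * The operators C and D *)

Lemma expw_bin2D k : w ^+ 'C(k + N, 2) = w ^+ 'C(k, 2).
Proof.
elim: k => [|k IH].
  (* As N is odd, it divides C(N, 2). *)
  by rewrite add0n bin2odd // exprM wN // expr1n.
by rewrite addSn !binS !bin1 !exprD IH wN // mulr1.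
Qed.

Lemma expw_bin2_mod k : w ^+ 'C(k %% N, 2) = w ^+ 'C(k, 2).
Proof.
rewrite [in RHS](divn_eq k N) addnC.
by elim: (k %/ N)%N => [|j IH]; rewrite ?addn0 // mulSn [(N + _)%N]addnC addnA expw_bin2D.
Qed.

(* [e_{-k}], without subtraction: [- k = k (N - 1)] modulo [N]. *)
Local Notation nebasis k := (ebasis (k * N.-1)).

Lemma nebasisS k : B *m nebasis k.+1 = nebasis k.
Proof.
rewrite Bop_ebasis //; apply: ebasis_mod.
by rewrite mulSn -addSn prednK // modnDl.
Qed.

Let wX_neq0 k : w ^+ k != 0. Proof. exact: expf_neq0 w_neq0. Qed.

Lemma expw_opp k : w ^+ (k * N.-1) = w ^- k.
Proof.
apply: (mulIf (wX_neq0 k)); rewrite (mulVf (wX_neq0 k)) -exprD -mulnSr prednK //.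
by rewrite mulnC exprM wN // expr1n.
Qed.

Lemma Aop_nebasis k : A *m nebasis k = w ^- k *: nebasis k.
Proof. by rewrite Aop_ebasis // expw_opp. Qed.

Lemma q_pronic k : q ^+ (k * k.-1) = w ^+ 'C(k, 2).
Proof. by rewrite -exprM mul2n bin2 halfK; case: k => // k; rewrite /= oddM /= andNb subn0. Qed.

Variable rt : C -> C.
Local Notation mroot := (mroot N rt).

Lemma antidiag_ebasis (P : 'M[C]_N) (d : nat -> C) k :
  (forall k, d (k %% N) = d k)%N ->
  (forall i j, P i j = (i + j == 0 %[mod N])%:R * d j) ->
  P *m ebasis k = d k *: nebasis k.
Proof.
move=> dmod Pd; rewrite (@ebasis_mod k (k %% N)) ?modn_mod //.
rewrite -[(k %% N)%N]/(nat_of_ord (Ordinal (ltn_pmod k N_pos))) ebasis_ord -colE.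
apply/colP => i; rewrite !mxE Pd /= dmod mulrC; congr (_ * _%:R).
rewrite -(eqn_modDr k (i : nat)) -mulnSr prednK // modnMl mod0n.
by rewrite modnDmr.
Qed.

Lemma Cop_ebasis l k (m := mroot l.2 l.1^-1) :
  Cop N rt l *m ebasis k = (w ^+ (k * m + 'C(k, 2)))^-1 *: nebasis k.
Proof.
apply: (@antidiag_ebasis _ (fun k => (w ^+ (k * m + 'C(k, 2)))^-1)) => [j|i j].
  by rewrite exprD mulnC exprM [in LHS]exprAC expw_mod // exprAC -exprM mulnC expw_bin2_mod -exprD.
by rewrite mxE q_pronic -mulnA exprM -invfM -exprD.
Qed.

Lemma Dop_ebasis l k (m := mroot l.2 l.1^-1) :
  Dop N rt l *m ebasis k = (w ^- (k * m) * w ^+ 'C(k, 2)) *: nebasis k.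
Proof.
apply: (@antidiag_ebasis _ (fun k => w ^- (k * m) * w ^+ 'C(k, 2))) => [j|i j].
  by rewrite mulnC exprM [in LHS]exprAC expw_mod // exprAC -exprM mulnC expw_bin2_mod.
by rewrite mxE q_pronic -mulnA exprM.
Qed.

(** This is (-k)(-k-1)/2 = (k+1)k/2 modulo N, with k (N - 1) in place of -k. *)
Lemma expw_bin2_opp k : w ^+ 'C(k * N.-1, 2) = w ^+ 'C(k.+1, 2).
Proof.
elim: k => [|k IH] //; apply: (mulfI (wX_neq0 (k.+1 * N.-1))).
have binSa a : (a + 'C(a, 2) = 'C(a.+1, 2))%N by rewrite binS bin1 addnC.
rewrite -exprD binSa.
have -> : (k.+1 * N.-1).+1 = (k * N.-1 + N)%N by rewrite mulSn addnC -addnS prednK.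
rewrite expw_bin2D IH expw_opp [in RHS]binS bin1 [in RHS]exprD [RHS]mulrCA.
by rewrite mulVf ?mulr1.
Qed.

Lemma ebasis_oppK k : nebasis (k * N.-1) = ebasis k.
Proof.
apply: ebasis_mod; case: N N_pos => [//|[|n]] _ /=; first by rewrite !modn1.
have -> : (k * n.+1 * n.+1 = (k * n) * n.+2 + k)%N by lia.
by rewrite modnMDl.
Qed.

Lemma Cop_conjA l : A *m Cop N rt l *m A = Cop N rt l.
Proof.
apply: eq_on_ebasis => // k; rewrite -!mulmxA Aop_ebasis // -!scalemxAr Cop_ebasis.
rewrite -!scalemxAr Aop_nebasis !scalerA; congr (_ *: _).
by rewrite mulrAC (mulfV (wX_neq0 k)) mul1r.
Qed.

Lemma Dop_conjA l : A *m Dop N rt l *m A = Dop N rt l.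
Proof.
apply: eq_on_ebasis => // k; rewrite -!mulmxA Aop_ebasis // -!scalemxAr Dop_ebasis.
rewrite -!scalemxAr Aop_nebasis !scalerA; congr (_ *: _).
by rewrite mulrAC (mulfV (wX_neq0 k)) mul1r.
Qed.

(** The scalar comes from the phase q^(-2im) in C; it will match the root of y/x with the product of
    the roots of y and 1/x. *)
Lemma Cop_conjB l : A *m Cop N rt l *m invmx B = w ^+ mroot l.2 l.1^-1 *: (B *m Cop N rt l).
Proof.
apply: eq_on_ebasisS => // k; rewrite -scalemxAl -!mulmxA invBop_ebasis // !Cop_ebasis.
rewrite -!scalemxAr Aop_nebasis nebasisS !scalerA; congr (_ *: _).
rewrite binS bin1 mulSn !exprD !invfM.
move: (wX_neq0 (mroot l.2 l.1^-1)) => h; move: (_ ^- _) (_ ^- _) (_ ^- _) => x y z.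
by rewrite -[X in _ = _ * X]mulrA mulVKf // mulrA.
Qed.

Lemma Dop_conjB l : w ^+ mroot l.2 l.1^-1 *: (Dop N rt l *m B) = invmx B *m Dop N rt l *m A.
Proof.
apply: eq_on_ebasis => // k; rewrite -scalemxAl -!mulmxA Aop_ebasis // Bop_ebasis //.
rewrite -!scalemxAr !Dop_ebasis -scalemxAr -[nebasis k]nebasisS mulKmx ?Bop_unit //.
rewrite !scalerA; congr (_ *: _).
rewrite binS bin1 mulSn !exprD !invfM.
move: (wX_neq0 (mroot l.2 l.1^-1)) => h; move: (_ ^- (k * _)) => x.
by rewrite -[X in _ * X]mulrA mulVKf // [RHS]mulrC mulrA.
Qed.

(** The phases in m at k and -k cancel, and C(k, 2) - C(k+1, 2) = -k is left in the exponent; in the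
    order D C it is k. *)
Lemma Cop_Dop l : A *m (Cop N rt l *m Dop N rt l) = 1%:M.
Proof.
apply: eq_on_ebasis => // k; rewrite mul1mx -!mulmxA Dop_ebasis -!scalemxAr Cop_ebasis.
rewrite ebasis_oppK -scalemxAr Aop_ebasis // !scalerA -[RHS]scale1r; congr (_ *: _).
rewrite exprD expw_bin2_opp mulnAC expw_opp binS bin1 exprD !invfM invrK.
move: (wX_neq0 k) (wX_neq0 'C(k, 2)) (wX_neq0 (k * mroot l.2 l.1^-1)).
by move: (w ^+ _) (w ^+ _) (w ^+ _) => x y z; move=> *; field; apply/and3P.
Qed.

Lemma Dop_Cop l : Dop N rt l *m Cop N rt l = A.
Proof.
apply: eq_on_ebasis => // k; rewrite -!mulmxA Cop_ebasis -!scalemxAr Dop_ebasis.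
rewrite ebasis_oppK Aop_ebasis // !scalerA; congr (_ *: _).
rewrite exprD expw_bin2_opp mulnAC expw_opp binS bin1 exprD !invfM invrK.
move: (wX_neq0 'C(k, 2)) (wX_neq0 (k * mroot l.2 l.1^-1)).
by move: (w ^+ _) (w ^+ _) (w ^+ _) => x y z; move=> *; field; apply/andP.
Qed.

(** * The chosen N-th roots *)

Hypothesis rtP : root_choice N rt.

Lemma rt_expN z : z != 0 -> rt z ^+ N = z. Proof. by case: rtP => H _ _ _; apply: H. Qed.
Lemma rtV z : z != 0 -> rt z^-1 = (rt z)^-1. Proof. by case: rtP => _ _ H _; apply: H. Qed.
Lemma rtN z : z != 0 -> rt (- z) = - rt z. Proof. by case: rtP => _ _ _ H; apply: H. Qed.

Lemma rt_neq0 z : z != 0 -> rt z != 0.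
Proof.
move=> z0; apply/eqP => rtz0; move: (z0).
by rewrite -(rt_expN z0) rtz0 expr0n gtn_eqF ?eqxx.
Qed.

(** The default value in [mroot] is not reached: the ratio of both roots is an N-th root of unity,
    hence a power of w. *)
Lemma mrootP z u : z != 0 -> u != 0 -> rt (z * u) = w ^+ mroot z u * rt z * rt u.
Proof.
move=> z0 u0; rewrite /mroot; case: pickP => [m /eqP->|no]; first by rewrite exprM.
have /(prim_rootP (w_prim))[m E] : (rt (z * u) / (rt z * rt u)) ^+ N = 1.
  by rewrite expr_div_n exprMn !rt_expN ?mulf_neq0 // divff ?mulf_neq0.
have /negP[] := no m; rewrite exprM -mulrA -E divfK ?mulf_neq0 ?rt_neq0 //.
Qed.

(** * A^Hom as a rotation; the operators U and S on the tensor square *)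

Lemma eq_on_tensS m (P Q : 'M[C]_(m, N * N)) :
  (forall j k, P *m tensv (ebasis j) (ebasis k.+1) = Q *m tensv (ebasis j) (ebasis k.+1)) ->
  P = Q.
Proof.
move=> E; apply: eq_on_tens => j k; rewrite (@ebasis_mod k (k + N.-1).+1) //.
by rewrite -addnS prednK // modnDr.
Qed.

Lemma sum_tensv_colE n p (f : 'M[C]_(n, p)) k j :
  (\sum_j tensv (col j f) (delta_mx j 0)) (mxtens_index (k, j)) 0 = f k j.
Proof.
rewrite summxE (bigD1 j) //= big1 ?addr0 => [|i ij]; rewrite tensvE !mxE ?eqxx ?mulr1 //.
by rewrite eq_sym (negbTE ij) mulr0.
Qed.

Lemma AHommx_mxrot l l' f :
  AHommx rt l l' f =
  mxrot ((Dop N rt (wdual l) *t 1%:M) *m f *m (Cop N rt (wmul l l'))^T).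
Proof.
apply/matrixP => k a; case: (mxtens_indexP k) => b c; rewrite mxrotE tens_mul_trE.
rewrite mxE /Avec mxE big_mxtens_index; apply: eq_bigr => a' _.
rewrite big_mxtens_index; apply: eq_bigr => b' _; apply: eq_bigr => c' _.
rewrite !tensmxE castmxE /=.
(* Both indices are the number (a' N + b') N + c', so the cast only reassociates. *)
have -> : cast_ord (esym (esym (mulnA N N N))) (mxtens_index (a', mxtens_index (b', c')))
   = mxtens_index (mxtens_index (a', b'), c').
  by apply: val_inj => /=; rewrite mulnDl mulnA addnA.
by rewrite (ord1 (cast_ord _ _)) sum_tensv_colE mulrA.
Qed.

Definition Uop : 'M[C]_(N * N) :=
  (B *t 1%:M) *m (1%:M *t A) *m (1%:M *t invmx B).

Lemma Uop_ebasis j k :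
  Uop *m tensv (ebasis j) (ebasis k.+1) = w ^+ k *: tensv (ebasis j.+1) (ebasis k).
Proof.
by rewrite -!mulmxA !tensv_mul !mul1mx invBop_ebasis Aop_ebasis Bop_ebasis tensvZr.
Qed.

(** The exponent adds up the second indices k, ..., k + n - 1 left by the successive
    applications. *)
Lemma UopX_ebasis n j k :
  Uop ^+ n *m tensv (ebasis j) (ebasis (k + n)) =
  w ^+ (k * n + 'C(n, 2)) *: tensv (ebasis (j + n)) (ebasis k).
Proof.
elim: n j => [|n IH] j; first by rewrite !addn0 muln0 !expr0 mul1mx scale1r.
rewrite exprSr -[(_ * _)%R]/(_ *m _) -mulmxA addnS Uop_ebasis -scalemxAr IH scalerA.
rewrite -exprD addSnnS; congr (w ^+ _ *: _).
by rewrite mulnS binS bin1; lia.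
Qed.

Lemma UopN : Uop ^+ N = 1.
Proof.
apply: eq_on_tens => j k; rewrite [RHS]mul1mx (@ebasis_mod k (k + N)) ?modnDr // UopX_ebasis.
rewrite exprD bin2odd // mulnC !exprM wN !expr1n mulr1 scale1r.
by rewrite (@ebasis_mod (j + N) j) ?modnDr // (@ebasis_mod (k + N) k) ?modnDr.
Qed.

Lemma Uop_tensA : Uop *m (A *t A) = (A *t A) *m Uop.
Proof.
apply: eq_on_tensS => j k; rewrite -?(mulmxA Uop) -?(mulmxA (_ *t _)).
rewrite tensv_mul !Aop_ebasis Uop_ebasis.
rewrite tensvZl tensvZr -!scalemxAr Uop_ebasis tensv_mul !Aop_ebasis tensvZl tensvZr !scalerA.
by congr (_ *: _); rewrite -!exprD; congr (_ ^+ _); lia.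
Qed.

Lemma Uop_tens1B : Uop *m (1%:M *t B) = B *t A.
Proof.
apply: eq_on_tens => j k; rewrite -?(mulmxA Uop) -?(mulmxA (_ *t _)).
rewrite !tensv_mul mul1mx !Bop_ebasis Uop_ebasis.
by rewrite Aop_ebasis tensvZr.
Qed.

Lemma Uop_comm1B : Uop *m (1%:M *t B) = w *: ((1%:M *t B) *m Uop).
Proof.
apply: eq_on_tensS => j k; rewrite -scalemxAl -?(mulmxA Uop) -?(mulmxA (_ *t _)).
rewrite tensv_mul mul1mx !Bop_ebasis.
by rewrite !Uop_ebasis -scalemxAr tensv_mul mul1mx Bop_ebasis scalerA -exprS.
Qed.

Lemma Sop_tensA : Sop R N *m (A *t A) = (1%:M *t A) *m Sop R N.
Proof.
apply: eq_on_tens => j k; rewrite -!mulmxA tensv_mul !Aop_ebasis Sop_ebasis tensv_mul mul1mx.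
by rewrite tensvZl tensvZr -!scalemxAr Sop_ebasis Aop_ebasis tensvZr scalerA exprD.
Qed.

Lemma Sop_tens1B : Sop R N *m (1%:M *t B) = (1%:M *t B) *m Sop R N.
Proof.
apply: eq_on_tens => j k; rewrite -!mulmxA tensv_mul mul1mx Bop_ebasis !Sop_ebasis tensv_mul.
by rewrite mul1mx Bop_ebasis addnS.
Qed.

Lemma Sop_unit : Sop R N \in unitmx.
Proof.
have SX n j k : Sop R N ^+ n *m tensv (ebasis j) (ebasis k) = tensv (ebasis j) (ebasis (n * j + k)).
  elim: n k => [|n IH] k; first by rewrite expr0 mul1mx.
  rewrite exprSr -[(_ * _)%R]/(_ *m _) -mulmxA Sop_ebasis IH; congr (tensv _ (ebasis _)); lia.
have : Sop R N *m Sop R N ^+ N.-1 = 1%:M.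
  rewrite -[LHS]exprS prednK //; apply: eq_on_tens => j k; rewrite SX mul1mx.
  by congr tensv; apply: ebasis_mod; rewrite mulnC modnMDl.
by case/mulmx1_unit.
Qed.

Lemma invBopX_A m : invmx B ^+ m *m A = w ^+ m *: (A *m invmx B ^+ m).
Proof.
have BA : invmx B *m A = w *: (A *m invmx B).
  apply: eq_on_ebasisS => k; rewrite -scalemxAl -!mulmxA invBop_ebasis !Aop_ebasis -scalemxAr.
  by rewrite invBop_ebasis scalerA exprS.
elim: m => [|m IH]; first by rewrite !expr0 scale1r mul1mx mulmx1.
rewrite exprS -[X in X *m A]/(_ *m _) -mulmxA IH -scalemxAr mulmxA BA -scalemxAl scalerA -exprSr.
by rewrite -mulmxA.
Qed.

Lemma invBopX_B m : invmx B ^+ m *m B = B *m invmx B ^+ m.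
Proof.
elim: m => [|m IH]; first by rewrite !expr0 mul1mx mulmx1.
rewrite exprS -[invmx B * _]/(_ *m _) -mulmxA IH !mulmxA.
by rewrite mulVmx ?mulmxV ?Bop_unit.
Qed.

Lemma invBopX_unit m : invmx B ^+ m \in unitmx.
Proof.
elim: m => [|m IH]; first by rewrite expr0 unitmx1.
by rewrite exprS -[invmx B * _]/(_ *m _) unitmx_mul unitmx_inv Bop_unit.
Qed.

(** * The isomorphism F *)

Variable zeta : C -> C -> C.
Hypothesis zetaP : zeta_choice N zeta.

Definition nonsing_pair (l l' : weight R) : Prop :=
  [/\ nonsingular l, nonsingular l' & nonsingular (wmul l l')].

Section Fop.
Variables l l' : weight R.
Hypothesis nonsing_ll' : nonsing_pair l l'.
Local Notation nu := (wmul l l').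
Local Notation V := (Wtens (Vrep N rt l) (Vrep N rt l')).

Let a := - (rt l.2 * rt l'.1 / rt nu.2).
Let c := rt l'.2 / rt nu.2.

Let FopE : Fop N rt zeta l l' =
  (1%:M *t (invmx B ^+ mroot l.1 l'.1)) *m Sop R N *m Phi N zeta a c Uop.
Proof. by rewrite /a /c /nu; case: l l' => [x y] [x' y']. Qed.

Let rt_neq0s : [/\ rt l.1 != 0, rt l.2 != 0, rt l'.1 != 0, rt l'.2 != 0 & rt nu.2 != 0].
Proof.
by case: nonsing_ll' => -[? ?] [? ?] [? ?]; split; exact: rt_neq0.
Qed.

Let ac1 : c ^+ N - a ^+ N = 1.
Proof.
case: nonsing_ll' => -[x0 y0] [x0' y0'] [_ yn0].
(* N odd gives (-1)^N = -1, so the difference becomes a sum with numerator y' + y x'. *)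
rewrite /a /c exprNn -signr_odd oddN expr1 mulN1r opprK !expr_div_n exprMn !rt_expN // -mulrDl.
by rewrite [l'.2 + _]addrC divff.
Qed.

Let zac0 : zeta a c != 0. Proof. exact: zetaP ac1. Qed.

(** The source of a and c: U carries 1 (x) B to B (x) A, so c - a U collects both summands of the
    action of Y. *)
Let VY : Yact V = rt nu.2 *: ((c%:M - a *: Uop) *m (1%:M *t B)).
Proof.
case: rt_neq0s => _ _ _ _ n0.
rewrite /= mulmxBl mul_scalar_mx -scalemxAl Uop_tens1B scalerBr !scalerA /a /c.
rewrite mulrN scaleNr opprK ![rt nu.2 * _]mulrC !divfK //.
by rewrite tensmxZl !tensmxZr scalerA addrC.
Qed.

Lemma Fop_unit : Fop N rt zeta l l' \in unitmx.
Proof.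
rewrite FopE !unitmx_mul Sop_unit Phi_unit ?UopN // andbT.
by rewrite tensmx_unit ?unitmx1 ?invBopX_unit // -lt0n.
Qed.

(** Phi commutes with A (x) A, S turns it into 1 (x) A, and the power of B supplies the w^m between
    the root of x x' and the product of the roots. *)
Lemma Fop_X :
  Fop N rt zeta l l' *m Xact V = (1%:M *t Xact (Vrep N rt nu)) *m Fop N rt zeta l l'.
Proof.
case: nonsing_ll' => -[x0 y0] [x0' y0'] _.
rewrite FopE [Xact V]/= [Xact _]/= tensmxZl !tensmxZr scalerA -scalemxAr -scalemxAl mrootP //.
rewrite -(mulmxA _ (Phi _ _ _ _ _)) (Phi_comm UopN zeta ac1 Uop_tensA) mulmxA.
rewrite -(mulmxA _ (Sop R N)) Sop_tensA.
move: (Phi _ _ _ _ _) (Sop R N) => P S; rewrite !mulmxA tensmx_mul mul1mx invBopX_A.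
rewrite tensmxZr -!scalemxAl scalerA.
by rewrite tensmx_mul mul1mx; congr (_ *: _); ring.
Qed.

(** By [Phi_shift], Phi absorbs the factor c - a U of [VY]; S and the power of B commute with 1 (x)
    B. *)
Lemma Fop_Y :
  Fop N rt zeta l l' *m Yact V = (1%:M *t Yact (Vrep N rt nu)) *m Fop N rt zeta l l'.
Proof.
have cU : Uop *m (c%:M - a *: Uop) = (c%:M - a *: Uop) *m Uop.
  by rewrite mulmxBr mulmxBl mul_mx_scalar mul_scalar_mx -scalemxAr -scalemxAl.
rewrite VY FopE /= tensmxZr -scalemxAr -scalemxAl; congr (_ *: _).
rewrite -(mulmxA _ (Phi _ _ _ _ _)) (mulmxA (Phi _ _ _ _ _)) (Phi_comm UopN zeta ac1 cU).
rewrite (Phi_shift UopN zeta ac1 Uop_comm1B) mulmxA -(mulmxA _ (Sop R N)) Sop_tens1B.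
move: (Phi _ _ _ _ _) (Sop R N) => P S.
by rewrite !mulmxA !tensmx_mul mul1mx invBopX_B.
Qed.

End Fop.

(** * Regular pairs and dual weights *)

(** If y x' + y' = 0, then Y is a nonzero multiple of (U - w^i)(1 (x) B) for some i. Conjugation by
    1 (x) B multiplies U by a power of w, so all U - w^j would be invertible and U would have no
    eigenvectors, against [sum_eigproj]. *)
Lemma nonsing_pair_of_regular l l' : regular N rt l l' -> nonsing_pair l l'.
Proof.
case=> -[x0 y0] [x0' y0'] _ uY; split=> //; split; first by rewrite mulf_neq0.
apply/eqP => n0.
have [b0 g0] : rt l.2 * rt l'.1 != 0 /\ rt l'.2 != 0 by rewrite mulf_neq0 !rt_neq0.
have YE : Yact (Wtens (Vrep N rt l) (Vrep N rt l'))
   = (rt l.2 * rt l'.1) *: ((Uop - (- (rt l'.2 / (rt l.2 * rt l'.1)))%:M) *m (1%:M *t B)).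
  rewrite mulmxBl mul_scalar_mx Uop_tens1B scalerBr scalerA mulrN mulrCA divff // mulr1.
  by rewrite scaleNr opprK /= tensmxZl !tensmxZr scalerA.
have /(prim_rootP w_prim)[i Ei] : (- (rt l'.2 / (rt l.2 * rt l'.1))) ^+ N = 1.
  rewrite exprNn -signr_odd oddN expr1 mulN1r expr_div_n exprMn !rt_expN // -mulNr.
  have -> : - l'.2 = l.2 * l'.1 by apply/eqP; rewrite eq_sym -addr_eq0; apply/eqP.
  by rewrite divff ?mulf_neq0.
have ui : Uop - (w ^+ i)%:M \in unitmx.
  by move: uY; rewrite YE Ei unitmxZ ?unitfE // unitmx_mul => /andP[].
have w_unit : w \is a GRing.unit by rewrite unitfE w_neq0.
have uB : (1%:M : 'M[C]_N) *t B \in unitmx by rewrite tensmx_unit ?unitmx1 ?Bop_unit // -lt0n.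
have uj j : Uop - (w ^+ (i + j))%:M \in unitmx.
  elim: j => [|j IH]; first by rewrite addn0.
  have : (Uop - (w ^+ (i + j.+1))%:M) *m (1%:M *t B) =
      w *: ((1%:M *t B) *m (Uop - (w ^+ (i + j))%:M)).
    rewrite mulmxBl mulmxBr Uop_comm1B scalerBr mul_scalar_mx mul_mx_scalar scalerA.
    by rewrite addnS [w ^+ (i + j).+1]exprS.
  move/(congr1 (fun P => P \in unitmx)).
  rewrite unitmx_mul uB andbT => ->.
  by rewrite (unitmxZ _ w_unit) unitmx_mul uB.
have P0 j : eigproj Uop j = 0.
  (* A shift by j - i, with i (N - 1) in place of -i. *)
  have u := uj (j + i * N.-1)%N.
  have E : w ^+ (i + (j + i * N.-1)) = w ^+ j.
    by rewrite addnCA -mulnS prednK // exprD mulnC exprM wN expr1n mulr1.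
  rewrite E in u; rewrite -(mulKmx u (eigproj _ _)) mulmxBl eigprojP ?UopN // mul_scalar_mx.
  by rewrite subrr mulmx0.
have := sum_eigproj UopN; rewrite big1 ?mul0mx => [|j _]; last exact: P0.
move/matrixP; pose o := mxtens_index (Ordinal N_pos, Ordinal N_pos).
by move/(_ o o)/esym/eqP; rewrite !mxE eqxx pnatr_eq0 -leqn0 leqNgt N_pos.
Qed.

Lemma wmul_dual l l' : nonsing_pair l l' -> wmul l' (wdual (wmul l l')) = wdual l.
Proof.
case: l l' => [x y] [x' y'] [[/= x0 y0] [x0' y0'] [xx0 yy0]].
by rewrite /wmul /wdual /=; congr pair; field; apply/andP.
Qed.

Lemma wdualK (l : weight R) : nonsingular l -> wdual (wdual l) = l.
Proof.
case: l => [x y] [/= x0 y0]; rewrite /wdual /= invrK; congr pair.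
by rewrite mulNr opprK divfK.
Qed.

Lemma nonsing_pair_rot l l' : nonsing_pair l l' -> nonsing_pair l' (wdual (wmul l l')).
Proof.
move=> g; have E := wmul_dual g; case: (g) => -[x0 y0] [x0' y0'] [xx0 yy0].
split=> //; first by split; rewrite ?invr_eq0 // oppr_eq0 mulf_neq0 ?invr_eq0.
by rewrite E; split; rewrite ?invr_eq0 // oppr_eq0 mulf_neq0 ?invr_eq0.
Qed.

(** * Intertwiners into a trivial module tensor V, and bijectivity of I *)

Definition emb (m : 'cV[C]_N) : 'M[C]_(N * N, N) :=
  \matrix_(k, j) tensv m (delta_mx j 0) k 0.

Lemma embE m a b j : emb m (mxtens_index (a, b)) j = m a 0 * (b == j)%:R.
Proof. by rewrite mxE tensvE !mxE eqxx andbT. Qed.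

Lemma emb_linear : linear emb.
Proof.
move=> a u v; apply/matrixP => k j; case: (mxtens_indexP k) => x y.
by rewrite [RHS]mxE [in RHS]mxE !embE !mxE mulrDl mulrA.
Qed.

Lemma emb_ebasis m k : emb m *m ebasis k = tensv m (ebasis k).
Proof.
rewrite (@ebasis_mod k (k %% N)) ?modn_mod //.
rewrite -[(k %% N)%N]/(nat_of_ord (Ordinal (ltn_pmod k N_pos))) ebasis_ord -colE.
by apply/colP => i; rewrite !mxE.
Qed.

Lemma emb_mul m P : emb m *m P = (1%:M *t P) *m emb m.
Proof.
apply/matrixP => k j; case: (mxtens_indexP k) => a b.
rewrite [LHS]mxE [RHS]mxE big_mxtens_index.
rewrite [RHS](bigD1 a) //= [X in _ = _ + X]big1 ?addr0 => [|i ia]; last first.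
  by rewrite big1 // => ? _; rewrite tensmxE mxE eq_sym (negbTE ia) !mul0r.
rewrite (bigD1 b) //= [X in _ + X]big1 ?addr0 => [|i ib]; last first.
  by rewrite embE eq_sym (negbTE ib) mulr0 mul0r.
rewrite [RHS](bigD1 j) //= [X in _ = _ + X]big1 ?addr0 => [|i ij]; last first.
  by rewrite embE (negbTE ij) !mulr0.
by rewrite tensmxE !embE !mxE !eqxx !mulr1 mul1r mulrC.
Qed.

Lemma emb_inj : injective emb.
Proof.
move=> m m' E; apply/colP => a; have /matrixP := E.
by move/(_ (mxtens_index (a, Ordinal N_pos)) (Ordinal N_pos)); rewrite !embE eqxx !mulr1.
Qed.

(* [A e_0 = e_0] forces [M e_0] into [C^N (x) e_0], and [e_0]
   is a cyclic vector for [B]. *)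
Lemma emb_commutant (M : 'M[C]_(N * N, N)) :
  M *m A = (1%:M *t A) *m M -> M *m B = (1%:M *t B) *m M -> exists m, M = emb m.
Proof.
move=> MA MB; pose o := Ordinal N_pos.
exists (\col_a M (mxtens_index (a, o)) o); set m := \col__ _.
apply: eq_on_ebasis => k; rewrite emb_ebasis.
elim: k => [|k IH]; last first.
  by rewrite -Bop_ebasis mulmxA MB -mulmxA IH tensv_mul mul1mx.
have M0 : (1%:M *t A) *m (M *m ebasis 0) = M *m ebasis 0.
  by rewrite mulmxA -MA -mulmxA Aop_ebasis expr0 scale1r.
have E0 : ebasis 0 = delta_mx o 0 by rewrite -ebasis_ord.
apply/colP => i; case: (mxtens_indexP i) => a b; rewrite tensvE [in RHS]E0.
rewrite [X in _ = X * _]mxE [X in _ = _ * X]mxE eqxx andbT.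
have [->|b0] := eqVneq b o; first by rewrite mulr1 E0 -colE mxE.
rewrite mulr0; move/colP/(_ (mxtens_index (a, b))): M0.
rewrite mxE big_mxtens_index (bigD1 a) //= [X in _ + X]big1 ?addr0 => [|j ja]; last first.
  by rewrite big1 // => ? _; rewrite tensmxE mxE eq_sym (negbTE ja) !mul0r.
rewrite (bigD1 b) //= big1 ?addr0 => [|j jb]; last first.
  by rewrite tensmxE !mxE eq_sym (negbTE jb) mulr0n mulr0 mul0r.
rewrite tensmxE !mxE !eqxx mulr1n mul1r exprM => /eqP.
rewrite -subr_eq0 -[X in _ - X]mul1r -mulrBl mulf_eq0 => /orP[|/eqP//].
rewrite subr_eq0 -(prim_order_dvd w_prim) gtnNdvd // lt0n.
by move: b0; rewrite -val_eqE => /negbTE ->.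
Qed.

Lemma ImxE l l' m : Imx rt zeta l l' m = invmx (Fop N rt zeta l l') *m emb m.
Proof. by apply/matrixP => k j; rewrite !mxE; apply: eq_bigr => i _; rewrite !mxE. Qed.

Lemma Imx_linear l l' : linear (@Imx R N rt zeta l l').
Proof. by move=> a u v; rewrite !ImxE emb_linear mulmxDr -scalemxAr. Qed.

Lemma Imx_inj l l' : nonsing_pair l l' -> injective (@Imx R N rt zeta l l').
Proof.
move=> g m m'; rewrite !ImxE => E; apply: emb_inj.
by rewrite -[emb m](mulKVmx (Fop_unit g)) E mulKVmx ?Fop_unit.
Qed.

Lemma Imx_Hsp l l' m : nonsing_pair l l' -> Imx rt zeta l l' m \in Hsp N rt (wmul l l') l l'.
Proof.
move=> g; have uF := Fop_unit g; apply/HomWP; rewrite !ImxE.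
split; apply: (can_inj (mulKmx uF)).
  by rewrite [RHS]mulmxA Fop_X // -!mulmxA !mulKVmx // emb_mul.
by rewrite [RHS]mulmxA Fop_Y // -!mulmxA !mulKVmx // emb_mul.
Qed.

Lemma Imx_surj l l' f : nonsing_pair l l' -> f \in Hsp N rt (wmul l l') l l' ->
  exists m, f = Imx rt zeta l l' m.
Proof.
move=> g /HomWP[fX fY]; have uF := Fop_unit g; case: (g) => _ _ [x0 y0].
have FX := Fop_X g; have FY := Fop_Y g.
have [||m E] := @emb_commutant (Fop N rt zeta l l' *m f).
- apply: (scalerI (rt_neq0 x0)).
  by rewrite scalemxAr -mulmxA fX mulmxA FX [Xact _]/= tensmxZr -mulmxA scalemxAl.
- apply: (scalerI (rt_neq0 y0)).
  by rewrite scalemxAr -mulmxA fY mulmxA FY [Yact _]/= tensmxZr -mulmxA scalemxAl.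
by exists m; rewrite ImxE -E mulKmx.
Qed.

(** * A^Hom preserves intertwiners *)

(** D is an invariant pairing of V_{l^*} with V_l, and C gives an invariant vector of V_{ll'} (x)
    V_{(ll')^*}, so the rotation lemmas apply. *)
Lemma AHommx_Hsp l l' f : nonsing_pair l l' -> f \in Hsp N rt (wmul l l') l l' ->
  AHommx rt l l' f \in Hsp N rt (wdual l) l' (wdual (wmul l l')).
Proof.
move=> [[x0 y0] [x0' y0'] [xn0 yn0]] /HomWP[fX fY]; apply/HomWP; rewrite AHommx_mxrot.
have trA : A^T = A by exact: tr_diag_mx.
have trZ a (P : 'M[C]_N) : (a *: P)^T = a *: P^T by apply/matrixP => i j; rewrite !mxE.
set n := wmul l l' in xn0 yn0 fX fY *.
have q0 : l.2 / l.1 != 0 by rewrite mulf_neq0 ?invr_eq0.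
have qn0 : n.2 / n.1 != 0 by rewrite mulf_neq0 ?invr_eq0.
have DX : (Xact (Vrep N rt (wdual l)))^T *m Dop N rt (wdual l) *m Xact (Vrep N rt l) =
    Dop N rt (wdual l).
  rewrite /= trZ trA -!scalemxAl -scalemxAr scalerA Dop_conjA rtV //.
  by rewrite mulVf ?rt_neq0 // scale1r.
have EX : Xact (Vrep N rt (wdual n)) *m Cop N rt n *m (Xact (Vrep N rt n))^T = Cop N rt n.
  rewrite /= trZ trA -!scalemxAl -scalemxAr scalerA Cop_conjA rtV //.
  by rewrite mulVf ?rt_neq0 // scale1r.
have DY : Dop N rt (wdual l) *m Yact (Vrep N rt l) =
   - ((Yact (Vrep N rt (wdual l)))^T *m Dop N rt (wdual l) *m Xact (Vrep N rt l)).
  rewrite /= trZ Bop_tr -!scalemxAl -!scalemxAr -Dop_conjB !scalerA -[RHS]scaleNr.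
  (* The index of D at l^* is m_{-y/x,x}; as (-y/x) x = -y, it relates the roots of y and y/x. *)
  congr (_ *: _); have := @mrootP (wdual l).2 (wdual l).1^-1; rewrite /= oppr_eq0 !invr_eq0.
  move=> /(_ q0 x0); rewrite invrK mulNr divfK // !rtN // mulrN mulNr => /oppr_inj ->.
  ring.
have EY : Yact (Vrep N rt (wdual n)) *m Cop N rt n =
   - (Xact (Vrep N rt (wdual n)) *m Cop N rt n *m (Yact (Vrep N rt n))^T).
  rewrite /= trZ Bop_tr -!scalemxAl -!scalemxAr Cop_conjB !scalerA -[RHS]scaleNr.
  congr (_ *: _); rewrite (rtN qn0) (mrootP yn0) ?invr_eq0 //.
  ring.
split.
  exact: (mxrot_intertwineX DX EX fX).
exact: (mxrot_intertwineY DY EX EY fX fY).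
Qed.

(** * From matrices to the maps between multiplicity spaces *)

Lemma ImapE nu l l' m : nonsing_pair l l' -> nu = wmul l l' ->
  vsval (Imap N rt zeta nu l l' m) = Imx rt zeta l l' m.
Proof.
move=> g ->; have lin : linear (vsproj (Hsp N rt (wmul l l') l l') \o @Imx R N rt zeta l l').
  by move=> a u v; rewrite /comp Imx_linear linearP.
rewrite /Imap (linfunE_of_linear lin); exact: vsprojK (Imx_Hsp m g).
Qed.

Lemma Imap_surj nu l l' (v : subvs_of (Hsp N rt nu l l')) :
  nonsing_pair l l' -> nu = wmul l l' -> exists m, v = Imap N rt zeta nu l l' m.
Proof.
move=> g nuE; have := subvsP v; rewrite {2}nuE => /(Imx_surj g)[m vE].
by exists m; apply: val_inj; rewrite [RHS](ImapE m g nuE) -vE.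
Qed.

Lemma AHommx_linear l l' : linear (@AHommx R N rt l l').
Proof.
move=> a f g; rewrite !AHommx_mxrot; set D := _ *t _; set E := _^T.
have -> : D *m (a *: f + g) *m E = a *: (D *m f *m E) + D *m g *m E.
  by rewrite mulmxDr mulmxDl -scalemxAr -scalemxAl.
by apply/matrixP => i j; rewrite !mxE.
Qed.

Lemma AHomE l l' f : nonsing_pair l l' ->
  vsval (AHom N rt l l' f) = AHommx rt l l' (vsval f).
Proof.
move=> g; have lin : linear (vsproj (Hsp N rt (wdual l) l' (wdual (wmul l l')))
    \o @AHommx R N rt l l' \o @vsval _ _ (Hsp N rt (wmul l l') l l')).
  move=> a u v; rewrite /comp; have -> : vsval (a *: u + v) = a *: vsval u + vsval v by [].
  by rewrite AHommx_linear linearP.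
rewrite /AHom (linfunE_of_linear lin); exact: vsprojK (AHommx_Hsp g (subvsP f)).
Qed.

(** The inverse in [Amap] is eliminated: it is a right inverse on the image of [Imap], which is
    everything. *)
Lemma Imx_Amap l l' m : nonsing_pair l l' ->
  Imx rt zeta l' (wdual (wmul l l')) (Amap N rt zeta l l' m) =
  AHommx rt l l' (Imx rt zeta l l' m).
Proof.
move=> g; have g' := nonsing_pair_rot g; have nuE := esym (wmul_dual g).
rewrite -(ImapE _ g' nuE) /Amap comp_lfunE limg_lfunVK.
  by rewrite comp_lfunE AHomE // ImapE.
have [m' ->] := Imap_surj ((AHom N rt l l' \o Imap N rt zeta (wmul l l') l l')%VF m) g' nuE.
exact: memv_img (memvf _).
Qed.

(** * The triple composite *)

Lemma AHommx3 l l' f : nonsing_pair l l' -> f \in Hsp N rt (wmul l l') l l' ->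
  AHommx rt (wdual (wmul l l')) l (AHommx rt l' (wdual (wmul l l')) (AHommx rt l l' f)) =
  w ^- mroot l.1 l'.1 *: f.
Proof.
move=> g /HomWP[fX _]; have g' := nonsing_pair_rot g; have wE := wmul_dual g'.
case: (g) => gl gl' gn; case: (gl) (gl') (gn) => [x0 _] [x0' _] [xn0 _].
rewrite (wmul_dual g) (wdualK gl) in wE.
(* C and D receive the common weight l^* on the first factor, l'^* on the second and l l' on the
   third. *)
rewrite !AHommx_mxrot wdualK // (wmul_dual g) wE mxrot3 Dop_Cop.
have trA : A^T = A by exact: tr_diag_mx.
have CDA l0 : Cop N rt l0 *m Dop N rt l0 *m A = 1%:M by apply: mulmx1C; exact: Cop_Dop.
apply: (scalerI (wX_neq0 (mroot l.1 l'.1))); rewrite scalerA mulfV // scale1r trA.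
have fA : w ^+ mroot l.1 l'.1 *: (f *m A) = (A *t A) *m f.
  apply: (@scalerI _ _ (rt l.1 * rt l'.1)); first by rewrite mulf_neq0 ?rt_neq0.
  move: fX; rewrite /= mrootP // tensmxZl tensmxZr scalerA -scalemxAr -scalemxAl => <-.
  by rewrite scalerA; congr (_ *: _); ring.
by rewrite -mulmxA scalemxAr fA mulmxA tensmx_mul !CDA tensmx1 mul1mx.
Qed.

End QuantumTorusModules.

Theorem proposition3p18 (R : realType) (N : nat) (rt : R[i] -> R[i])
    (zeta : R[i] -> R[i] -> R[i]) (l l' : weight R) :
  odd N -> root_choice N rt -> zeta_choice N zeta -> regular N rt l l' ->
  (Amap N rt zeta (wdual (wmul l l')) l
     \o (Amap N rt zeta l' (wdual (wmul l l'))
           \o Amap N rt zeta l l'))%VF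
  = (qroot R N ^- (2 * mroot N rt l.1 l'.1)) *: \1%VF.
Proof.
move=> oddN rtP zetaP /(nonsing_pair_of_regular oddN rtP) g.
have g2 := nonsing_pair_rot g; have E2 := wmul_dual g.
have g3 := nonsing_pair_rot g2; have E3 := wmul_dual g2.
have ll : wdual (wdual l) = l by case: g => gl _ _; exact: wdualK gl.
have ll' : wdual (wdual l') = l' by case: g => _ gl' _; exact: wdualK gl'.
(* The third pair arises as ((ll')^*, l^{**}), here identified with ((ll')^*, l); the next rotation
   returns to (l, l'). *)
rewrite E2 ll in g3 E3.
have H1 m := Imx_Amap oddN rtP zetaP m g.
have H2 m := Imx_Amap oddN rtP zetaP m g2.
have H3 m := Imx_Amap oddN rtP zetaP m g3.
rewrite E2 ll in H2; rewrite E3 ll' in H3.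
have AHommx3_Imx m := AHommx3 oddN rtP g (Imx_Hsp oddN rtP zetaP m g).
have Imx_injective := Imx_inj oddN rtP zetaP g.
have ImxZ := scalable_linear (Imx_linear (N:=N) rt zeta l l').
(* Generalizing the maps [Amap] keeps [comp_lfunE] from unfolding them. *)
move: (Amap N rt zeta l l') (Amap N rt zeta l' _) (Amap N rt zeta _ l) H1 H2 H3.
move=> F1 F2 F3 H1 H2 H3; apply/lfunP => m; apply: Imx_injective.
by rewrite scale_lfunE id_lfunE !comp_lfunE H3 H2 H1 AHommx3_Imx exprM ImxZ.
Qed.
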